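(* Consider the minimum-time interception problem (OCP) described in the context, with $v_x=V_T\cos\theta_T$, $v_y=V_T\sin\theta_T$ and $\theta_{P_0}=\pi/2$. If the solution path of the OCP is of type $C_\alpha S_d^\beta C_\gamma$, the following four statements hold. (1) If both $C_\alpha$ and $C_\gamma$ are right-turning circular arcs, then $$a_1+a_2\sin\beta+a_3\cos\beta=0,$$ where $$a_1=(\rho-\rho\sin\theta_{P_f})v_y-\Big(\frac{v_y}{v_x}\bar x_0-\bar y_0+\rho\cos\theta_{P_f}\Big)v_x,$$ $$a_2=-\rho+\rho\sin\theta_{P_f}-\Big(-\frac{\bar x_0}{v_x}-\rho(\theta_{P_0}-\theta_{P_f}+2n\pi)\Big)v_x,$$ $$a_3=\frac{v_y}{v_x}\bar x_0-\bar y_0+\rho\cos\theta_{P_f}+\Big(-\frac{\bar x_0}{v_x}-\rho(\theta_{P_0}-\theta_{P_f}+2n\pi)\Big)v_y,$$ with $n=0$ if $\theta_{P_f}<\pi/2$ and $n=1$ if $\theta_{P_f}\ge\pi/2$. (2) If both $C_\alpha$ and $C_\gamma$ are left-turning circular arcs, then $$b_1+b_2\sin\beta+b_3\cos\beta=0,$$ where $$b_1=(-\rho+\rho\sin\theta_{P_f})v_y-\Big(\frac{v_y}{v_x}\bar x_0-\bar y_0-\rho\cos\theta_{P_f}\Big)v_x,$$ $$b_2=\rho-\rho\sin\theta_{P_f}+\Big(\frac{\bar x_0}{v_x}+\rho(\theta_{P_f}-\theta_{P_0}+2n\pi)\Big)v_x,$$ $$b_3=\Big(-\frac{\bar x_0}{v_x}-\rho(\theta_{P_f}-\theta_{P_0}+2n\pi)\Big)v_y+\frac{v_y}{v_x}\bar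 x_0-\bar y_0-\rho\cos\theta_{P_f},$$ with $n=0$ if $\theta_{P_f}\ge\pi/2$ and $n=1$ if $\theta_{P_f}<\pi/2$. (3) If $C_\alpha$ is a right-turning circular arc and $C_\gamma$ is a left-turning circular arc, then $$c_1+c_2\sin\beta+c_3\cos\beta+\beta(c_4\sin\beta+c_5\cos\beta)=0,$$ where $$c_1=2\rho+(\rho+\rho\sin\theta_{P_f})v_y-\Big(-\rho\cos\theta_{P_f}+\frac{v_y}{v_x}\bar x_0-\bar y_0\Big)v_x,$$ $$c_2=-2\rho v_y-\Big(-\frac{\bar x_0}{v_x}-\rho(\theta_{P_0}+\theta_{P_f}+2n\pi)\Big)v_x-\rho-\rho\sin\theta_{P_f},$$ $$c_3=-2\rho v_x+\Big(-\frac{\bar x_0}{v_x}-\rho(\theta_{P_0}+\theta_{P_f}+2n\pi)\Big)v_y-\rho\cos\theta_{P_f}+\frac{v_y}{v_x}\bar x_0-\bar y_0,$$ $$c_4=-2\rho v_x,\qquad c_5=2\rho v_y,$$ with $n=0$ if $\theta_{P_0}>\beta$ and $\theta_{P_f}>\beta$; $n=1$ if $(\theta_{P_0}-\beta)(\theta_{P_f}-\beta)<0$; $n=2$ if $\theta_{P_0}<\beta$ and $\theta_{P_f}<\beta$. (4) If $C_\alpha$ is a left-turning circular arc and $C_\gamma$ is a right-turning circular arc, then $$d_1+d_2\sin\beta+d_3\cos\beta+\beta(d_4\sin\beta+d_5\cos\beta)=0,$$ where $$d_1=-2\rho+(-\rho-\rho\sin\theta_{P_f})v_y-\Big(\rho\cos\theta_{P_f}+\frac{v_y}{v_x}\bar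 x_0-\bar y_0\Big)v_x,$$ $$d_2=2\rho v_y-\Big(-\frac{\bar x_0}{v_x}+\rho(\theta_{P_0}+\theta_{P_f}+2n\pi)\Big)v_x+\rho+\rho\sin\theta_{P_f},$$ $$d_3=2\rho v_x+\Big(-\frac{\bar x_0}{v_x}+\rho(\theta_{P_0}+\theta_{P_f}+2n\pi)\Big)v_y+\rho\cos\theta_{P_f}+\frac{v_y}{v_x}\bar x_0-\bar y_0,$$ $$d_4=2\rho v_x,\qquad d_5=-2\rho v_y,$$ with $n=0$ if $\theta_{P_0}<\beta$ and $\theta_{P_f}<\beta$; $n=1$ if $(\theta_{P_0}-\beta)(\theta_{P_f}-\beta)<0$; $n=2$ if $\theta_{P_0}>\beta$ and $\theta_{P_f}>\beta$.
   Context: Setting. A pursuer moves forward in the plane with constant speed $V_P>0$ and minimum turning radius $\rho>0$. Its position $(x_P,y_P)\in\mathbb{R}^2$ and heading angle $\theta_P\in[0,2\pi]$ (measured counter-clockwise from the positive $x$-axis) obey $$\dot x_P=V_P\cos\theta_P,\quad \dot y_P=V_P\sin\theta_P,\quad \dot\theta_P=V_P\,u/\rho,$$ where the control $u$ takes values in $[-1,1]$. The initial state at $t=0$ is $(0,0,\pi/2)$, so the initial heading is $\theta_{P_0}=\pi/2$. A nonmaneuvering target starts at $(\bar x_0,\bar y_0)$ and moves with constant speed $V_T>0$ and constant heading angle $\theta_T\in[0,2\pi]$, so its position at time $t\ge 0$ is $(x_T(t),y_T(t))=(\bar x_0,\bar y_0)+V_Tt(\cos\theta_T,\sin\theta_T)$.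 Its velocity is $(v_x,v_y)=(V_T\cos\theta_T,V_T\sin\theta_T)$. It is assumed throughout that $V_T/V_P<1$. OCP. Given an impact angle $\phi_f\in[0,2\pi)$, find a minimum time $t_f>0$ so that the pursuer is steered by a measurable control $u(\cdot)\in[-1,1]$ on $[0,t_f]$ from $(0,0,\pi/2)$ at $t=0$ to intercept the target at $t_f$ with impact angle $\phi_f$, i.e. $(x_P(t_f),y_P(t_f))=(x_T(t_f),y_T(t_f))$ and $\phi_f=\theta_P(t_f)-\theta_T$. The final heading of the pursuer is thus fixed: $\theta_{P_f}:=\phi_f+\theta_T$. The solution path is the path of the pursuer under the optimal control. The distance between the initial and final positions of the pursuer is assumed to be at least $4\rho$. Path types. $C_\alpha$ denotes a circular arc of radius $\rho$ and radian (angle swept) $\alpha\ge 0$; it is right-turning if $u=-1$ and left-turning if $u=1$. $S_d^\beta$ denotes a straight line segment ($u=0$) of length $d\ge 0$, where $\beta\in[0,2\pi)$ is its orientation angle with respect to the $x$-axis. $C_\alpha S_d^\beta C_\gamma$ denotes the concatenation, in this order, of a circular arc $C_\alpha$, a segment $S_d^\beta$ and a circular arc $C_\gamma$.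
   Formalization: v_x, v_y are divided by V_P (the formulas presuppose V_P=1); in (4) n is 0, -1, -2 instead of 0, 1, 2; at θ_Pf=π/2 in (1) and (2) n is 0 for a straight path and 1 for a full turn; v_x≠0 is assumed; θ_Pf is φ_f+θ_T reduced modulo 2π to [0,2π). *)

(* Defs.v *)
(* MathComp-Analysis world: the reals are an arbitrary R : realType. *)
From HB Require Import structures.
From mathcomp Require Import all_boot all_order all_algebra.
From mathcomp Require Import all_classical all_reals all_analysis.

Set Implicit Arguments.
Unset Strict Implicit.
Unset Printing Implicit Defensive.

Import Order.TTheory GRing.Theory Num.Theory.
Import numFieldNormedType.Exports.

Local Open Scope classical_set_scope.
Local Open Scope ring_scope.

(* State headings are real-valued lifts of angles, so prescribed headings are
   compared modulo 2 pi. *)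
Definition eq_angle (R : realType) (a b : R) : Prop :=
  exists k : int, a = b + k%:~R * (2 * pi).

Definition theta0 (R : realType) : R := pi / 2.

(* The representative in [0, 2 pi[ of phif + thT, for phif in [0, 2 pi[ and
   thT in [0, 2 pi]. *)
Definition final_heading (R : realType) (phif thT : R) : R :=
  if phif + thT < 2 * pi then phif + thT else phif + thT - 2 * pi.

(* Borel measurability is no loss: a Lebesgue measurable control agrees almost
   everywhere with a Borel one, which generates the same trajectory. *)
Definition admissible_control (R : realType) (tf : R) (u : R -> R) : Prop :=
  measurable_fun (`[0, tf] : set R) u /\
  (forall t, 0 <= t <= tf -> -1 <= u t <= 1).

(* Caratheodory solution of x' = VP cos th, y' = VP sin th, th' = VP u / rho
   on [0, tf], starting from (0, 0, pi / 2). *)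
Definition pursuer_trajectory (R : realType) (VP rho tf : R)
    (u x y th : R -> R) : Prop :=
  forall t, 0 <= t <= tf ->
    [/\ x t = \int[@lebesgue_measure R]_(s in `[0, t]) (VP * cos (th s)),
        y t = \int[@lebesgue_measure R]_(s in `[0, t]) (VP * sin (th s)) &
        th t = theta0 R
               + \int[@lebesgue_measure R]_(s in `[0, t]) (VP * u s / rho)].

Definition target_x (R : realType) (VT thT x0 t : R) : R :=
  x0 + VT * t * cos thT.

Definition target_y (R : realType) (VT thT y0 t : R) : R :=
  y0 + VT * t * sin thT.

Definition intercepts (R : realType) (VP rho VT thT x0 y0 phif tf : R)
    (u x y th : R -> R) : Prop :=
  [/\ 0 < tf,
      admissible_control tf u,
      pursuer_trajectory VP rho tf u x y th,
      (x tf = target_x VT thT x0 tf /\ y tf = target_y VT thT y0 tf) &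
      eq_angle (th tf - thT) phif].

Definition OCP_solution (R : realType) (VP rho VT thT x0 y0 phif tf : R)
    (u x y th : R -> R) : Prop :=
  intercepts VP rho VT thT x0 y0 phif tf u x y th /\
  (forall (tf' : R) (u' x' y' th' : R -> R),
     intercepts VP rho VT thT x0 y0 phif tf' u' x' y' th' -> tf <= tf').

Inductive turn : Type := TurnRight | TurnLeft.

Definition turn_control (R : realType) (c : turn) : R :=
  match c with TurnRight => -1 | TurnLeft => 1 end.

Definition control_is (R : realType) (u : R -> R) (a b c : R) : Prop :=
  {ae @lebesgue_measure R, forall t : R, a < t < b -> u t = c}.

(* The path followed on [0, tf] is C_alpha S_d^beta C_gamma, the two arcs
   turning as prescribed by c1 and c2.  The heading at the end of the first arc
   is the orientation of the segment, also when d = 0. *)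
Definition CSC_path (R : realType) (VP rho tf : R) (u th : R -> R)
    (c1 c2 : turn) (alpha d beta gamma : R) : Prop :=
  let t1 := rho * alpha / VP in
  let t2 := (rho * alpha + d) / VP in
  [/\ 0 <= alpha, 0 <= d, 0 <= gamma & 0 <= beta < 2 * pi] /\
  [/\ tf = (rho * alpha + d + rho * gamma) / VP,
      control_is u 0 t1 (turn_control R c1),
      control_is u t1 t2 0,
      control_is u t2 tf (turn_control R c2) &
      eq_angle (th t1) beta].

(* The integer n of the formulas: it makes
     RR: pi/2 - thf + 2 n pi            LL: thf - pi/2 + 2 n pi
     RL: pi/2 + thf - 2 beta + 2 n pi   LR: 2 beta - pi/2 - thf - 2 n pi
   the total turning alpha + gamma.  For thf = pi/2 two parallel turns amount
   either to 0 (a straight path) or to a full turn. *)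
Definition n_RR (R : realType) (thf alpha gamma : R) (n : int) : Prop :=
  (n = 0 /\ (thf < theta0 R \/ alpha + gamma = 0)) \/
  (n = 1 /\ theta0 R <= thf /\ alpha + gamma <> 0).

Definition n_LL (R : realType) (thf alpha gamma : R) (n : int) : Prop :=
  (n = 0 /\ (theta0 R < thf \/ alpha + gamma = 0)) \/
  (n = 1 /\ thf <= theta0 R /\ alpha + gamma <> 0).

Definition n_RL (R : realType) (thf beta : R) (n : int) : Prop :=
  [\/ n = 0 /\ (beta < theta0 R /\ beta < thf),
      n = 1 /\ (theta0 R - beta) * (thf - beta) < 0 |
      n = 2 /\ (theta0 R < beta /\ thf < beta)].

(* The values are nonpositive because LR_d2 and LR_d3 contain
   pi/2 + thf + 2 n pi = 2 beta - (alpha + gamma). *)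
Definition n_LR (R : realType) (thf beta : R) (n : int) : Prop :=
  [\/ n = 0 /\ (theta0 R < beta /\ thf < beta),
      n = -1 /\ (theta0 R - beta) * (thf - beta) < 0 |
      n = -2 /\ (beta < theta0 R /\ beta < thf)].

Definition RR_a1 (R : realType) (rho x0 y0 vx vy thf : R) : R :=
  (rho - rho * sin thf) * vy - (vy / vx * x0 - y0 + rho * cos thf) * vx.

Definition RR_a2 (R : realType) (rho x0 vx thf : R) (n : int) : R :=
  - rho + rho * sin thf
  - (- (x0 / vx) - rho * (theta0 R - thf + 2 * n%:~R * pi)) * vx.

Definition RR_a3 (R : realType) (rho x0 y0 vx vy thf : R) (n : int) : R :=
  vy / vx * x0 - y0 + rho * cos thf
  + (- (x0 / vx) - rho * (theta0 R - thf + 2 * n%:~R * pi)) * vy.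

Definition LL_b1 (R : realType) (rho x0 y0 vx vy thf : R) : R :=
  (- rho + rho * sin thf) * vy - (vy / vx * x0 - y0 - rho * cos thf) * vx.

Definition LL_b2 (R : realType) (rho x0 vx thf : R) (n : int) : R :=
  rho - rho * sin thf
  + (x0 / vx + rho * (thf - theta0 R + 2 * n%:~R * pi)) * vx.

Definition LL_b3 (R : realType) (rho x0 y0 vx vy thf : R) (n : int) : R :=
  (- (x0 / vx) - rho * (thf - theta0 R + 2 * n%:~R * pi)) * vy
  + vy / vx * x0 - y0 - rho * cos thf.

Definition RL_c1 (R : realType) (rho x0 y0 vx vy thf : R) : R :=
  2 * rho + (rho + rho * sin thf) * vy
  - (- (rho * cos thf) + vy / vx * x0 - y0) * vx.

Definition RL_c2 (R : realType) (rho x0 vx vy thf : R) (n : int) : R :=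
  - (2 * rho * vy)
  - (- (x0 / vx) - rho * (theta0 R + thf + 2 * n%:~R * pi)) * vx
  - rho - rho * sin thf.

Definition RL_c3 (R : realType) (rho x0 y0 vx vy thf : R) (n : int) : R :=
  - (2 * rho * vx)
  + (- (x0 / vx) - rho * (theta0 R + thf + 2 * n%:~R * pi)) * vy
  - rho * cos thf + vy / vx * x0 - y0.

Definition RL_c4 (R : realType) (rho vx : R) : R := - (2 * rho * vx).

Definition RL_c5 (R : realType) (rho vy : R) : R := 2 * rho * vy.

Definition LR_d1 (R : realType) (rho x0 y0 vx vy thf : R) : R :=
  - (2 * rho) + (- rho - rho * sin thf) * vy
  - (rho * cos thf + vy / vx * x0 - y0) * vx.

Definition LR_d2 (R : realType) (rho x0 vx vy thf : R) (n : int) : R :=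
  2 * rho * vy
  - (- (x0 / vx) + rho * (theta0 R + thf + 2 * n%:~R * pi)) * vx
  + rho + rho * sin thf.

Definition LR_d3 (R : realType) (rho x0 y0 vx vy thf : R) (n : int) : R :=
  2 * rho * vx
  + (- (x0 / vx) + rho * (theta0 R + thf + 2 * n%:~R * pi)) * vy
  + rho * cos thf + vy / vx * x0 - y0.

Definition LR_d4 (R : realType) (rho vx : R) : R := 2 * rho * vx.

Definition LR_d5 (R : realType) (rho vy : R) : R := - (2 * rho * vy).

(* Main.v *)
Require Import Defs.
From HB Require Import structures.
From mathcomp Require Import all_boot all_order all_algebra.
From mathcomp Require Import all_classical all_reals all_analysis.
From mathcomp Require Import measurable_realfun.
From mathcomp Require Import ring lra.
Import Order.TTheory GRing.Theory Num.Theory.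
Import numFieldNormedType.Exports.
Local Open Scope ring_scope.

Set Implicit Arguments.
Unset Strict Implicit.
Unset Printing Implicit Defensive.

(** Integrating the dynamics along a circular arc, a segment and a circular arc
    gives the final position of the pursuer in terms of beta, d, the final
    heading and the signs of the two turns.  Equating it with the position
    (x0, y0) + VP tf (vx, vy) of the target, where
    VP tf = rho (alpha + gamma) + d, gives

      d (cos beta - vx) = P,   d (sin beta - vy) = Q,

    with P and Q free of d, and eliminating d gives
    P (sin beta - vy) - Q (cos beta - vx) = 0, which is the stated equation as
    soon as alpha + gamma is expressed through the final heading, beta and n
    ([RR_equation] and its three companions).  The final heading determines
    alpha + gamma only modulo 2 pi, so the whole content of n is that an optimal
    path contains no superfluous loop: each arc sweeps at most 2 pi, and so do
    two parallel arcs together ([CSC_no_loop], [CSC_same_turn]).  The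
    minimality of tf is used only there.

    A superfluous loop is excluded by length.  Let D be the distance from the
    start to the interception point.  A loop of angle 2 pi contributes to the
    length but not to the displacement, so a path with one has length more than
    2 pi rho + D.  The key lemma [optimal_length_bound] says that, when
    D >= 4 rho, the length of an optimal path is at most 2 pi rho + D.

    Shortening a longer path is not enough to contradict optimality, because the
    target reaches the interception point only at the time tf: an earlier
    interception takes place elsewhere, and the pursuer must be there at exactly
    the right time.  This is achieved by first replacing the path by a detour of
    the same length and the same end points that has three straight segments of
    positive lengths with different directions.  The displacement and the total
    length are linear in the three segment lengths, and this system is
    invertible; hence, for every small e, the lengths can be adjusted so that
    the path gets shorter by e while its end moves back by e (vx, vy), where the
    target was at the time tf - e / VP ([early_legs]).

    The detour ([detour_exists]) turns to a heading perpendicular to the line of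
    sight from the start to the interception point, makes a half turn through
    the direction of that line, and turns to the final heading, with a segment
    at each of the headings at the beginning, the middle and the end of the half
    turn.  Whether the half turn is made to the right or to the left is chosen
    by comparing how far the initial and the final headings point to the side of
    the line of sight; with the right choice the three arcs have total length at
    most 2 pi rho and bring the pursuer at most 4 rho closer to the
    interception point, so the segments have room for what remains.  When
    nothing remains for the middle segment, which requires D = 4 rho, turning
    slightly more than described makes room for it. *)

(** * Trigonometry *)

Lemma ler_sinB (R : realType) (a b : R) : `|sin a - sin b| <= `|a - b|.
Proof.
wlog ab : a b / b <= a => [wl|].
  by have [/wl|/ltW/wl] := leP b a; rewrite // distrC (distrC a).
have dsin x : x \in `]b, a[ -> is_derive x 1 sin (cos x)
  by move=> _; exact: is_derive_sin.
have [c _ ->] := MVT_segment ab dsin (continuous_subspaceT (@continuous_sin R)).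
by rewrite normrM ler_piMl// cos_max.
Qed.

Lemma ler_cosB (R : realType) (a b : R) : `|cos a - cos b| <= `|a - b|.
Proof.
rewrite -(sinDpihalf a) -(sinDpihalf b) (le_trans (ler_sinB _ _))//.
by rewrite opprD addrACA subrr addr0.
Qed.

(** Halving the angle reduces the strict bound to cos (x / 2) < 1 and the
    Lipschitz bound at x / 2. *)
Lemma ltr_norm_sin (R : realType) (x : R) : 0 < x -> `|sin x| < x.
Proof.
move=> x0; have [x2|x2] := leP 2 x.
  by rewrite (le_lt_trans (sin_max x))// (lt_le_trans _ x2)// ltr1n.
have h0 : 0 < sin (x / 2) by apply: sin2_gt0; lra.
have c0 : 0 < cos (x / 2).
  by apply: cos_gt0_pihalf; have := pihalf_ge1 R; lra.
have c1 : cos (x / 2) < 1.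
  have pi2 := pi_ge2 R; rewrite -[X in _ < X](cos0 R) ltr_cos ?divr_gt0//.
  - by rewrite in_itv/= lexx pi_ge0.
  - by rewrite in_itv/=; apply/andP; split; lra.
have : `|sin (x / 2) - sin 0| <= `|x / 2 - 0| by exact: ler_sinB.
rewrite sin0 !subr0 gtr0_norm// gtr0_norm ?divr_gt0// => h1.
have -> : sin x = 2 * (cos (x / 2) * sin (x / 2)).
  by rewrite {1}(splitr x) sinD mulr_natl mulr2n (mulrC (sin _)).
rewrite gtr0_norm ?mulr_gt0//.
have : cos (x / 2) * sin (x / 2) < sin (x / 2) by rewrite gtr_pMl.
lra.
Qed.

Lemma sin_sub_half (R : realType) (a b : R) :
  sin a - sin b = 2 * (sin ((a - b) / 2) * cos ((a + b) / 2)).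
Proof.
have {1}-> : a = (a + b) / 2 + (a - b) / 2 by field.
have {3}-> : b = (a + b) / 2 - (a - b) / 2 by field.
rewrite sinD sinB; ring.
Qed.

Lemma ltr_sinB (R : realType) (a b : R) : a != b ->
  `|sin a - sin b| < `|a - b|.
Proof.
move=> ab; have ab0 : 0 < `|a - b| / 2 by rewrite divr_gt0// normr_gt0 subr_eq0.
rewrite sin_sub_half normrM ger0_norm// normrM.
have := ltr_norm_sin ab0.
have -> : `|sin (`|a - b| / 2)| = `|sin ((a - b) / 2)|.
  have -> : `|a - b| / 2 = `|(a - b) / 2| by rewrite normrM (@ger0_norm _ 2^-1).
  by case: (ler0P ((a - b) / 2)) => // _; rewrite sinN normrN.
have : `|sin ((a - b) / 2)| * `|cos ((a + b) / 2)| <= `|sin ((a - b) / 2)|.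
  by rewrite ler_piMr// cos_max.
lra.
Qed.

Lemma cos_periodz (R : realType) (x : R) (k : int) :
  cos (x + k%:~R * (2 * pi)) = cos x.
Proof.
have E n y : cos (y + n%:R * (2 * pi)) = cos y :> R.
  have -> : n%:R * (2 * pi) = pi *+ 2 *+ n :> R
    by rewrite mulr_natl -(mulr_natl pi).
  exact: (periodicn (@cosD2pi R)).
case: k => n; first exact: E.
by rewrite NegzE mulrNz -(E n.+1) mulNr subrK.
Qed.

Lemma sin_periodz (R : realType) (x : R) (k : int) :
  sin (x + k%:~R * (2 * pi)) = sin x.
Proof. by rewrite -!cosBpihalf addrAC cos_periodz. Qed.

(** For the converse, an angle of [0, 2 pi[ whose cosine is 1 vanishes, because
    cos r = 1 - 2 (sin (r / 2))^2. *)
Lemma eq_angleP (R : realType) (a b : R) :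
  eq_angle a b <-> cos a = cos b /\ sin a = sin b.
Proof.
split=> [[k ->]|[cab sab]]; first by rewrite cos_periodz sin_periodz.
have pi0 := pi_gt0 R.
pose k : int := Num.floor ((a - b) / (2 * pi)).
pose r := a - b - k%:~R * (2 * pi).
have r0 : 0 <= r.
  by rewrite subr_ge0 -ler_pdivlMr ?mulr_gt0// floor_le.
have r2 : r < 2 * pi.
  have := floorD1_gt ((a - b) / (2 * pi)).
  rewrite -/k ltr_pdivrMr ?mulr_gt0// intrD mulrDl mul1r /r.
  by rewrite -ltrBlDl.
have cr : cos r = 1.
  rewrite /r -mulNr -mulrNz cos_periodz cosB cab sab -!expr2.
  exact: cos2Dsin2.
exists k; have [r00|rn0] := eqVneq r 0; first by move: r00; rewrite /r; lra.
have s0 : 0 < sin (r / 2) by apply: sin_gt0_pi; move: rn0 r0; lra.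
have := cos_mulr2n (r / 2); rewrite cos2sin2 mulr2n -splitr cr.
have : 0 < sin (r / 2) ^+ 2 by rewrite exprn_gt0.
lra.
Qed.

Lemma unit_vector_angle (R : realType) (x y : R) : x ^+ 2 + y ^+ 2 = 1 ->
  exists t : R, cos t = x /\ sin t = y.
Proof.
move=> xy; have x1 : -1 <= x <= 1.
  rewrite -ler_norml -(@ler_sqr _ _ 1) ?nnegrE// real_normK ?num_real//.
  by rewrite expr1n -xy lerDl sqr_ge0.
have cx : cos (acos x) = x by rewrite acosK// in_itv.
have sx : sin (acos x) = `|y|.
  by rewrite sin_acos// -xy addrC addKr sqrtr_sqr.
have [y0|y0] := lerP 0 y.
  by exists (acos x); rewrite cx sx ger0_norm.
by exists (- acos x); rewrite cosN sinN cx sx ltr0_norm// opprK.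
Qed.

(** Reflecting h in the vertical axis when its cosine is negative brings it
    into the right half circle without changing its sine. *)
Lemma folded_angle (R : realType) (h : R) : exists (a s : R),
  [/\ s = 1 \/ s = -1, - (pi / 2) <= a <= pi / 2,
      sin a = sin h & s * cos a = cos h].
Proof.
have h1 : -1 <= sin h <= 1 by rewrite sin_geN1 sin_le1.
have sa : sin (asin (sin h)) = sin h by rewrite asinK// in_itv.
have ca : cos (asin (sin h)) = `|cos h|.
  by rewrite cos_asin// -cos2sin2 sqrtr_sqr.
have [c0|c0] := lerP 0 (cos h).
  exists (asin (sin h)), 1; rewrite asin_geNpi2// asin_lepi2// sa ca.
  by split=> //; [left|rewrite mul1r ger0_norm].
exists (asin (sin h)), (-1); rewrite asin_geNpi2// asin_lepi2// sa ca.
by split=> //; [right|rewrite ltr0_norm// mulN1r opprK].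
Qed.

Lemma polar_form (R : realType) (x y : R) : exists t : R,
  x = Num.sqrt (x ^+ 2 + y ^+ 2) * cos t /\
  y = Num.sqrt (x ^+ 2 + y ^+ 2) * sin t.
Proof.
set r := Num.sqrt _; have r2 : r ^+ 2 = x ^+ 2 + y ^+ 2.
  by rewrite sqr_sqrtr// addr_ge0// sqr_ge0.
have [r0|rn0] := eqVneq r 0.
  exists 0; move: r2; rewrite r0 expr0n/= => /esym/eqP.
  by rewrite paddr_eq0 ?sqr_ge0// !sqrf_eq0 !mul0r => /andP[/eqP-> /eqP->].
have [|t [ct st]] := @unit_vector_angle R (x / r) (y / r).
  by rewrite !expr_div_n -mulrDl -r2 divff// expf_neq0.
by exists t; rewrite ct st !(mulrC r) !divfK.
Qed.

Lemma int_turns (R : realType) (k n : int) :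
  (n%:~R - 1) * (2 * pi) < k%:~R * (2 * pi : R) ->
  k%:~R * (2 * pi) < (n%:~R + 1) * (2 * pi : R) -> k = n.
Proof.
have p0 : 0 < 2 * pi :> R by rewrite mulr_gt0// pi_gt0.
rewrite !ltr_pM2r// -[1]/(1%:~R) -intrB -intrD !ltr_int => h1 h2.
by apply/eqP; rewrite eq_le -ltzD1 h2 -ltzD1 -ltrBlDr h1.
Qed.

Definition is_sign (R : realType) (s : R) : Prop := s = 1 \/ s = -1.

Lemma cosD_sign (R : realType) (s x a : R) : is_sign s ->
  cos (x + s * a) = cos x * cos a - s * (sin x * sin a).
Proof. by case=> ->; [rewrite !mul1r cosD|rewrite !mulN1r cosB opprK]. Qed.

Lemma sinD_sign (R : realType) (s x a : R) : is_sign s ->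
  sin (x + s * a) = sin x * cos a + s * (cos x * sin a).
Proof. by case=> ->; [rewrite !mul1r sinD|rewrite !mulN1r sinB]. Qed.

Lemma sign_sqr (R : realType) (s : R) : is_sign s -> s * s = 1.
Proof. by case=> ->; rewrite ?mulrNN mulr1. Qed.

Lemma sign_mul (R : realType) (s t : R) :
  is_sign s -> is_sign t -> is_sign (s * t).
Proof.
by move=> [->|->] [->|->]; rewrite /is_sign ?mul1r ?mulN1r ?opprK; auto.
Qed.

Lemma turn_control_sign (R : realType) (c : turn) : is_sign (turn_control R c).
Proof. by case: c; [right|left]. Qed.

(** A full circle moves nothing, so the progress of an arc of angle a > 2 pi in
    any fixed direction is that of an arc of angle a - 2 pi. *)
Lemma excess_turn (R : realType) (s a t : R) : is_sign s -> 2 * pi < a ->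
  s * (sin (t + s * a) - sin t) < a - 2 * pi.
Proof.
move=> ss a2; have pi0 := pi_gt0 R.
have E : sin (t + s * a) = sin (t + s * (a - 2 * pi)).
  case: ss => ->; rewrite ?mul1r ?mulN1r.
    by rewrite -[RHS](sin_periodz _ 1) mul1r; congr sin; ring.
  by rewrite -[LHS](sin_periodz _ 1) mul1r; congr sin; ring.
have ap : 0 < a - 2 * pi by lra.
have N : `|s * (a - 2 * pi)| = a - 2 * pi.
  by case: ss => ->; rewrite ?mul1r ?mulN1r ?normrN gtr0_norm.
have ne : t + s * (a - 2 * pi) != t.
  by rewrite -subr_eq0 addrAC subrr add0r -normr_gt0 N.
have := ltr_sinB ne; rewrite -E addrAC subrr add0r N.
apply: le_lt_trans; case: ss => ->; rewrite ?mul1r ?mulN1r ?ler_norm//.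
by rewrite -normrN ler_norm.
Qed.

Lemma turn_advance_le (R : realType) (s a t : R) : is_sign s -> 0 <= a ->
  s * (sin (t + s * a) - sin t) <= a.
Proof.
move=> ss a0; have := ler_sinB (t + s * a) t; rewrite addrAC subrr add0r.
have -> : `|s * a| = a
  by case: ss => ->; rewrite ?mul1r ?mulN1r ?normrN ger0_norm.
apply: le_trans; case: ss => ->; rewrite ?mul1r ?mulN1r ?ler_norm//.
by rewrite -normrN ler_norm.
Qed.

(** * Integrals along piecewise constant controls *)

Section Integration.
Local Open Scope classical_set_scope.
Variable R : realType.
Local Notation mu := (@lebesgue_measure R).

Lemma Rintegral_FTC (f F : R -> R) (a b : R) : a <= b ->
  continuous f -> (forall t : R, is_derive t 1 F (f t)) ->
  \int[mu]_(s in `[a, b]) f s = F b - F a.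
Proof.
rewrite le_eqVlt => /predU1P[<- _ _|ab cf dF].
  by rewrite set_itv1 Rintegral_set1 subrr.
rewrite /Rintegral (@continuous_FTC2 _ _ F)//.
- exact: continuous_subspaceT.
- have cF : continuous F.
    move=> t; apply: differentiable_continuous.
    by apply/derivable1_diffP; case: (dF t).
  split.
  + by move=> t _; case: (dF t).
  + by apply: cvg_at_right_filter; exact: cF.
  + by apply: cvg_at_left_filter; exact: cF.
- by move=> t _; rewrite derive1E; apply: derive_val.
Qed.

Lemma Rintegral_itv_cat (f : R -> R) (a b T : R) :
  mu.-integrable `[0, T] (EFin \o f) -> 0 <= a -> a <= b -> b <= T ->
  \int[mu]_(s in `[0, b]) f s =
  \int[mu]_(s in `[0, a]) f s + \int[mu]_(s in `[a, b]) f s.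
Proof.
move=> fi a0 ab bT.
have fib : mu.-integrable `[0, b] (EFin \o f).
  by apply: integrableS fi => //; apply: subset_itvl; rewrite bnd_simp.
have := @Rintegral_itvB R f (BLeft 0) (BRight b) a fib.
rewrite !bnd_simp => /(_ a0 ab) E.
rewrite -[LHS](subrK (\int[mu]_(s in `[0, a]) f s)) E addrC; congr (_ + _).
apply: Rintegral_itv_obnd_cbnd.
by apply: integrableS fib => //; apply: subset_itvr; rewrite bnd_simp.
Qed.

Lemma Rintegral_ae_cst (u : R -> R) (a b c T : R) :
  0 <= a -> a <= b -> b <= T ->
  measurable_fun `[0, T] u -> control_is u a b c ->
  \int[mu]_(s in `[a, b]) u s = c * (b - a).
Proof.
move=> a0 ab bT mu_ uc.
have mab : measurable_fun `[a, b] u.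
  by apply: measurable_funS mu_ => //; apply: subset_itv; rewrite bnd_simp.
transitivity (\int[mu]_(s in `[a, b]) c); last first.
  rewrite Rintegral_cst//= lebesgue_measure_itv/= lte_fin.
  by case: ifPn => [|/negP]; rewrite // => /negP; rewrite -leNgt => ba;
    have -> : a = b by [apply/eqP; rewrite eq_le ab]; rewrite subrr.
rewrite /Rintegral; congr fine; apply: ae_eq_integral => //.
- exact/measurable_EFinP.
- have n1 : mu.-negligible [set a].
    by exists [set a]; split => //; exact: lebesgue_measure_set1.
  have n2 : mu.-negligible [set b].
    by exists [set b]; split => //; exact: lebesgue_measure_set1.
  apply: negligibleS (negligibleU uc (negligibleU n1 n2)).
  move=> t /= /not_implyP[]; rewrite in_itv/= => /andP[at_ tb] ne.
  have [->|ta] := eqVneq t a; first by right; left.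
  have [->|tb'] := eqVneq t b; first by right; right.
  left => /= H; apply: ne; rewrite H// !lt_neqAle.
  by rewrite eq_sym ta tb' at_ tb.
Qed.

Lemma bounded_control_integrable (u : R -> R) (T : R) :
  admissible_control T u -> mu.-integrable `[0, T] (EFin \o u).
Proof.
move=> [mu_ ub]; apply: measurable_bounded_integrable => //.
  by rewrite /= lebesgue_measure_itv/=; case: ifP; rewrite ?ltry// -EFinD ltry.
exists 1; split; first exact: num_real.
move=> M M1 t /=; rewrite in_itv/= => tT.
by rewrite (le_trans _ (ltW M1))// ler_norml ub.
Qed.

End Integration.

(** * Paths made of arcs and segments *)

Section Legs.
Variables (R : realType) (rho : R).

(** A leg (c, l) is a piece of path of length l flown with the constant control
    c: a segment when c = 0, an arc of radius rho when c is 1 or -1. *)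
Fixpoint end_heading (h : R) (legs : seq (R * R)) : R :=
  if legs is (c, l) :: legs' then end_heading (h + c * l / rho) legs' else h.

(** Only the displacement along the direction of angle 0 is recorded.  The one
    along the direction of angle phi is obtained by subtracting phi from the
    initial heading; in particular phi = pi / 2 gives the second coordinate. *)
Definition leg_advance (h c l : R) : R :=
  if c == 0 then l * cos h else rho / c * (sin (h + c * l / rho) - sin h).

Fixpoint advance (h : R) (legs : seq (R * R)) : R :=
  if legs is (c, l) :: legs'
  then leg_advance h c l + advance (h + c * l / rho) legs' else 0.

Fixpoint path_length (legs : seq (R * R)) : R :=
  if legs is (_, l) :: legs' then l + path_length legs' else 0.

Lemma advance_rotate (h phi : R) (legs : seq (R * R)) :
  advance (h - phi) legs =
  cos phi * advance h legs + sin phi * advance (h - pi / 2) legs.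
Proof.
elim: legs h => [|[c l] legs IH] h /=; first by rewrite !mulr0 addr0.
rewrite addrAC (addrAC h (- (pi / 2))) IH /leg_advance.
case: ifP => _; last rewrite (addrAC h (- phi)) (addrAC h (- (pi / 2))).
  by rewrite cosBpihalf cosB; ring.
rewrite !sinBpihalf !sinB; ring.
Qed.

End Legs.

Section Trajectory.
Local Open Scope classical_set_scope.
Variables (R : realType) (VP rho tf : R).
Hypotheses (VP_gt0 : 0 < VP) (rho_gt0 : 0 < rho).
Local Notation mu := (@lebesgue_measure R).

Fixpoint follows_legs (u : R -> R) (a : R) (legs : seq (R * R)) : Prop :=
  if legs is (c, l) :: legs' then
    [/\ 0 <= l, control_is u a (a + l / VP) c &
        follows_legs u (a + l / VP) legs']
  else True.

Lemma follows_length_ge0 (u : R -> R) (a : R) (legs : seq (R * R)) :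
  follows_legs u a legs -> 0 <= path_length legs.
Proof.
by elim: legs a => [//|[c l] legs IH] a /= [l0 _ /IH]; exact: addr_ge0.
Qed.

(** On a leg the heading is affine in time, so cos is integrated exactly. *)
Lemma leg_integral (th : R -> R) (phi h c a b : R) : a <= b ->
  (forall s, a <= s <= b -> th s = h + c * (VP * (s - a)) / rho) ->
  \int[mu]_(s in `[a, b]) (VP * cos (th s - phi)) =
  leg_advance rho (h - phi) c (VP * (b - a)).
Proof.
move=> ab thE.
pose w := c * VP / rho.
transitivity (\int[mu]_(s in `[a, b]) (VP * cos (w * s + (h - phi - w * a)))).
  apply: eq_Rintegral => s; rewrite inE/= in_itv/= => sab; rewrite thE// /w.
  by congr (_ * cos _); ring.
have cf k : continuous (fun s : R => VP * cos (w * s + k)).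
  move=> s; apply: cvgM; first exact: cvg_cst.
  apply: (@continuous_comp _ _ _ (fun s : R => w * s + k) cos);
    last exact: continuous_cos.
  by apply: cvgD; [apply: cvgM; [exact: cvg_cst|exact: cvg_id]|exact: cvg_cst].
rewrite /leg_advance; have [c0|cn0] := eqVneq c 0.
  have dF (t : R) : is_derive t (1 : R) (fun s : R => VP * cos (h - phi) * s)
      (VP * cos (w * t + (h - phi - w * a))).
    rewrite /w c0 !mul0r add0r subr0.
    by apply: is_derive_eq; rewrite /GRing.scale/= mulr1.
  by rewrite (Rintegral_FTC ab (cf _) dF); ring.
have wn0 : w != 0 by rewrite /w !mulf_neq0// ?invr_eq0 gt_eqF.
have dF (t : R) : is_derive t (1 : R)
    (fun s : R => VP / w * sin (w * s + (h - phi - w * a)))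
    (VP * cos (w * t + (h - phi - w * a))).
  have dl : is_derive t (1 : R) (fun s : R => w * s + (h - phi - w * a)) w.
    by apply: is_derive_eq; rewrite /GRing.scale/= mulr1 addr0.
  have ds := @is_derive1_comp R sin _ t _ _ (is_derive_sin _) dl.
  have dz := is_deriveZ (VP / w) ds.
  by apply: (is_derive_eq dz); rewrite /GRing.scale/=; field.
rewrite (Rintegral_FTC ab (cf _) dF).
have -> : VP / w = rho / c by rewrite /w; field; rewrite cn0 !gt_eqF.
rewrite -mulrBr; congr (_ * (sin _ - sin _)); last by ring.
by rewrite /w; ring.
Qed.

Variables u x y th : R -> R.
Hypothesis u_adm : admissible_control tf u.
Hypothesis traj : pursuer_trajectory VP rho tf u x y th.

(** The heading is an integral with variable upper bound; its continuity makes
    the velocity integrable, which is what splitting the integrals at the ends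
    of the legs requires. *)
Lemma heading_continuous : 0 <= tf -> {within `[0, tf], continuous th}.
Proof.
move=> tf0.
have iu := bounded_control_integrable u_adm.
have iv : mu.-integrable `[0, tf] (EFin \o (fun s => VP * u s / rho)).
  have := @integrableZl _ _ _ mu `[0, tf] (measurable_itv _) (VP / rho) _ iu.
  by apply: eq_integrable => // s _ /=; rewrite -EFinM; congr EFin; ring.
have c1 := @parameterized_integral_continuous R 0 tf _ tf0 iv.
have c2 : {within `[0, tf], continuous
    (fun t => theta0 R + \int[mu]_(s in `[0, t]) (VP * u s / rho))}.
  by move=> t; apply: cvgD; [exact: cvg_cst|exact: c1].
apply: subspace_eq_continuous c2 => t; rewrite inE/= in_itv/= => t0.
by have [_ _ thE] := traj t0; rewrite /from_subspace thE.
Qed.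

Lemma speed_integrable (phi : R) : 0 <= tf ->
  mu.-integrable `[0, tf] (EFin \o (fun s => VP * cos (th s - phi))).
Proof.
move=> tf0; apply: continuous_compact_integrable; first exact: segment_compact.
move=> s; apply: cvgM; first exact: cvg_cst.
apply: continuous_comp; last exact: continuous_cos.
by apply: cvgB; [exact: heading_continuous|exact: cvg_cst].
Qed.

Lemma heading_on_leg (a b c s : R) : 0 <= a -> a <= s -> s <= b -> b <= tf ->
  control_is u a b c -> th s = th a + c * (VP * (s - a)) / rho.
Proof.
move=> a0 as_ sb bt uc.
have iu := bounded_control_integrable u_adm.
have [_ _ ->] := traj (t := s) ltac:(lra).
have [_ _ ->] := traj (t := a) ltac:(lra).
have E t : 0 <= t -> t <= tf -> \int[mu]_(s0 in `[0, t]) (VP * u s0 / rho) =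
    VP / rho * \int[mu]_(s0 in `[0, t]) u s0.
  move=> t0 tt; rewrite -RintegralZl//; last first.
    by apply: integrableS iu => //; apply: subset_itvl; rewrite bnd_simp.
  by apply: eq_Rintegral => r _; ring.
rewrite !E; try lra.
rewrite (Rintegral_itv_cat iu a0 as_); last lra.
rewrite (@Rintegral_ae_cst _ u a s c tf)//; [ring|lra|by case: u_adm|].
by apply: negligibleS uc => r /= nH H; apply: nH => r1; apply: H; lra.
Qed.

(** By induction on the legs, starting at an arbitrary time a: the integral up
    to tf is split at the end of the first leg. *)
Lemma trajectory_along (phi : R) (legs : seq (R * R)) (a : R) : 0 <= a ->
  follows_legs u a legs -> tf = a + path_length legs / VP ->
  th tf = end_heading rho (th a) legs /\
  \int[mu]_(s in `[0, tf]) (VP * cos (th s - phi)) =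
  \int[mu]_(s in `[0, a]) (VP * cos (th s - phi)) +
    advance rho (th a - phi) legs.
Proof.
elim: legs a => [|[c l] legs IH] a a0 /=.
  by move=> _; rewrite mul0r addr0 => ->; rewrite addr0.
move=> [l0 uc fl] tfE.
pose b := a + l / VP.
have ab : a <= b by rewrite lerDl divr_ge0// ltW.
have tfE' : tf = b + path_length legs / VP by rewrite tfE /b; ring.
have pl := follows_length_ge0 fl.
have bt : b <= tf by rewrite tfE' lerDl divr_ge0// ltW.
have [|h1 h2] := IH b _ fl tfE'; first lra.
have thb : th b = th a + c * l / rho.
  rewrite (heading_on_leg a0 ab (lexx b) bt uc) /b.
  by congr (_ + _ / rho); field; rewrite gt_eqF.
rewrite h1 h2 thb; split=> //.
have isp := @speed_integrable phi ltac:(lra).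
rewrite (Rintegral_itv_cat isp a0 ab bt) -addrA; congr (_ + _).
rewrite (@leg_integral _ _ (th a) c)//; last first.
  move=> s /andP[as_ sb]; exact: heading_on_leg uc.
have -> : VP * (b - a) = l by rewrite /b; field; rewrite gt_eqF.
by congr (_ + advance _ _ _); ring.
Qed.

(** The control is prescribed only almost everywhere on each leg; this is
    enough, since the state depends on it through integrals. *)
Theorem trajectory_endpoint (legs : seq (R * R)) :
  follows_legs u 0 legs -> tf = path_length legs / VP ->
  [/\ th tf = end_heading rho (pi / 2) legs,
      x tf = advance rho (pi / 2) legs &
      y tf = advance rho 0 legs].
Proof.
move=> fl tfE; have tf0 : 0 <= tf.
  by rewrite tfE divr_ge0 ?(follows_length_ge0 fl) ?ltW.
have th0 : th 0 = pi / 2.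
  have [_ _ ->] := traj (t := 0) ltac:(lra).
  by rewrite set_itv1 Rintegral_set1 addr0.
have tfE' : tf = 0 + path_length legs / VP by rewrite add0r.
have [h hx] := trajectory_along 0 (lexx _) fl tfE'.
have [_ hy] := trajectory_along (pi / 2) (lexx _) fl tfE'.
move: hx hy; rewrite !set_itv1 !Rintegral_set1 !add0r h th0 !subrr !subr0.
move=> hx hy.
have [xE yE _] := traj (t := tf) ltac:(lra).
split=> //; first by rewrite xE -hx; apply: eq_Rintegral => s _; rewrite subr0.
by rewrite yE -hy; apply: eq_Rintegral => s _; rewrite cosBpihalf.
Qed.

End Trajectory.

Section LegAdvance.
Variables (R : realType) (rho : R).
Hypothesis rho_gt0 : 0 < rho.

Lemma leg_advance_straight (h l : R) : leg_advance rho h 0 l = l * cos h.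
Proof. by rewrite /leg_advance eqxx. Qed.

Lemma leg_advance_turn (h c a : R) : is_sign c ->
  leg_advance rho h c (rho * a) = rho * c * (sin (h + c * a) - sin h).
Proof.
move=> sc; have c0 : c != 0.
  by case: sc => ->; rewrite ?oppr_eq0 oner_eq0.
rewrite /leg_advance (negbTE c0); have -> : rho / c = rho * c.
  by rewrite -[X in X / c]mulr1 -(sign_sqr sc); field.
by congr (_ * (sin (_ + _) - _)); field; rewrite gt_eqF.
Qed.

End LegAdvance.

Lemma end_heading_shift (R : realType) (rho h k : R) (legs : seq (R * R)) :
  end_heading rho (h + k) legs = end_heading rho h legs + k.
Proof. by elim: legs h => [//|[c l] legs IH] h /=; rewrite addrAC IH. Qed.

Definition valid_leg (R : realType) (p : R * R) : bool :=
  (-1 <= p.1 <= 1) && (0 <= p.2).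

Section LegsControl.
Local Open Scope classical_set_scope.
Variables (R : realType) (VP rho : R).
Hypotheses (VP_gt0 : 0 < VP) (rho_gt0 : 0 < rho).
Local Notation mu := (@lebesgue_measure R).

Fixpoint legs_control (legs : seq (R * R)) (s : R) : R :=
  if legs is (c, l) :: legs' then
    if s < l / VP then c else legs_control legs' (s - l / VP)
  else 0.

Lemma measurable_legs_control (legs : seq (R * R)) :
  measurable_fun [set: R] (legs_control legs).
Proof.
elim: legs => [|[c l] legs IH] /=; first exact: measurable_cst.
apply: measurable_fun_ifT => //.
- by apply: measurable_fun_ltr.
- by apply: measurableT_comp IH _; exact: measurable_funB.
Qed.

Lemma legs_control_bounded (legs : seq (R * R)) (s : R) :
  all (@valid_leg R) legs -> -1 <= legs_control legs s <= 1.
Proof.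
elim: legs s => [|[c l] legs IH] s /=; first by move=> _; rewrite lerN10 ler01.
by move=> /andP[/andP[c1 _] al]; case: ifP => _; [exact: c1|exact: IH].
Qed.

Lemma follows_legs_control (u : R -> R) (a : R) (legs : seq (R * R)) :
  all (@valid_leg R) legs ->
  (forall s, a < s -> u s = legs_control legs (s - a)) ->
  follows_legs VP u a legs.
Proof.
elim: legs a => [//|[c l] legs IH] a /= /andP[/andP[_ l0] al] uE.
have l0' : 0 <= l / VP by rewrite divr_ge0// ltW.
split=> //.
  by apply: aeW => t /andP[at_ tb]; rewrite uE// ltrBlDl tb.
apply: IH => // s sa; rewrite uE ?ifF; last 2 first.
- by apply/negbTE; rewrite -leNgt lerBrDl ltW.
- by apply: le_lt_trans sa; rewrite lerDl.
by congr legs_control; ring.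
Qed.

(** Heading and position are defined as the integrals themselves, so that the
    equations of motion hold by construction. *)
Lemma legs_trajectory (legs : seq (R * R)) :
  all (@valid_leg R) legs ->
  exists (u x y th : R -> R), let tf := path_length legs / VP in
  [/\ admissible_control tf u,
      pursuer_trajectory VP rho tf u x y th,
      th tf = end_heading rho (pi / 2) legs,
      x tf = advance rho (pi / 2) legs &
      y tf = advance rho 0 legs].
Proof.
move=> al; pose u := legs_control legs.
pose th t := theta0 R + \int[mu]_(s in `[0, t]) (VP * u s / rho).
pose x t := \int[mu]_(s in `[0, t]) (VP * cos (th s)).
pose y t := \int[mu]_(s in `[0, t]) (VP * sin (th s)).
exists u, x, y, th => tf.
have ua : admissible_control tf u.
  split; last by move=> t _; exact: legs_control_bounded.
  by apply: measurable_funTS; exact: measurable_legs_control.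
have tr : pursuer_trajectory VP rho tf u x y th by [].
have fl : follows_legs VP u 0 legs.
  by apply: follows_legs_control => // s _; rewrite subr0.
by have [-> -> ->] := trajectory_endpoint VP_gt0 rho_gt0 ua tr fl erefl.
Qed.

End LegsControl.

(** * Detours with three segments *)

Section Detour.
Variables (R : realType) (rho : R).
Hypothesis rho_gt0 : 0 < rho.

(** In these formulas headings are measured from the line of sight.  The first
    arc leads from the initial heading to the heading sg (pi / 2 + m), the two
    middle arcs turn back through 0 to - sg (pi / 2 + m), and the last arc leads
    to the final heading.  The sign sg selects one of two mirror images.  The
    angles i and k are the initial and final headings, mirrored by sg and folded
    into [- pi / 2, pi / 2]; s1 and s2 are 1 when no folding was needed.  With
    s1 = 1 the first arc turns in the sense opposite to the middle arcs; with
    s1 = -1 it turns in the same sense as they do.  The last arc is similar. *)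
Definition detour (sg s1 s2 m i k d1 d2 d3 : R) : seq (R * R) :=
  [:: (sg * s1, rho * (pi / 2 - i + s1 * m)); (0, d1);
      (- sg, rho * (pi / 2 + m)); (0, d2);
      (- sg, rho * (pi / 2 + m)); (0, d3);
      (sg * s2, rho * (k + pi / 2 + s2 * m))].

Lemma detour_length (sg s1 s2 m i k d1 d2 d3 : R) :
  path_length (detour sg s1 s2 m i k d1 d2 d3) =
  rho * (2 * pi - (i - k) + (2 + s1 + s2) * m) + d1 + d2 + d3.
Proof. by rewrite /=; field. Qed.

Section DetourEndpoint.
Variables (sg s1 s2 m i k d1 d2 d3 h : R).
Hypotheses (sgs : is_sign sg) (s1s : is_sign s1) (s2s : is_sign s2).
Hypotheses (sin_i : sin i = sg * sin h) (cos_i : s1 * cos i = cos h).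
Local Notation legs := (detour sg s1 s2 m i k d1 d2 d3).

Let h1 := h + sg * s1 * (pi / 2 - i + s1 * m).
Let h2 := h1 + - sg * (pi / 2 + m).
Let h3 := h2 + - sg * (pi / 2 + m).
Let h4 := h3 + sg * s2 * (k + pi / 2 + s2 * m).

Let first_heading : cos h1 = - sin m /\ sin h1 = sg * cos m.
Proof.
have ss1 := sign_sqr s1s; have ssg := sign_sqr sgs.
have -> : h1 = h + (sg * s1) * (pi / 2 - i) + sg * m.
  rewrite /h1; have -> : m = (s1 * s1) * m by rewrite ss1 mul1r.
  by ring: ss1.
have sm := sign_mul sgs s1s.
have C : cos (h + sg * s1 * (pi / 2 - i)) = 0.
  rewrite cosD_sign// cosB sinB cos_pihalf sin_pihalf !mul0r !mul1r add0r subr0.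
  rewrite -cos_i sin_i.
  have -> : sin h = sg * sin i by rewrite sin_i mulrA ssg mul1r.
  ring: ssg.
have S : sin (h + sg * s1 * (pi / 2 - i)) = sg.
  rewrite sinD_sign// cosB sinB cos_pihalf sin_pihalf !mul0r !mul1r add0r subr0.
  rewrite -cos_i; have -> : sin h = sg * sin i by rewrite sin_i mulrA ssg mul1r.
  have E := sin2cos2 i; ring: E ss1.
move: C S; set h' := h + _ => C S.
rewrite cosD_sign// sinD_sign// C S; split; first by ring: ssg.
by rewrite !mul0r mulr0 addr0.
Qed.

Let middle_heading : cos h2 = 1 /\ sin h2 = 0.
Proof.
have ssg := sign_sqr sgs; have [C S] := first_heading.
have sN : is_sign (- sg) by case: sgs => ->; rewrite /is_sign ?opprK; auto.
have E := sin2cos2 m.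
rewrite /h2 (cosD_sign h1 _ sN) (sinD_sign h1 _ sN) C S.
rewrite cosD sinD cos_pihalf sin_pihalf.
split; [ring: E ssg|ring].
Qed.

Let last_heading : cos h3 = - sin m /\ sin h3 = - sg * cos m.
Proof.
have [C S] := middle_heading.
have sN : is_sign (- sg) by case: sgs => ->; rewrite /is_sign ?opprK; auto.
rewrite /h3 (cosD_sign h2 _ sN) (sinD_sign h2 _ sN) C S.
rewrite cosD sinD cos_pihalf sin_pihalf.
by split; ring.
Qed.

Lemma detour_heading :
  cos (end_heading rho h legs) = s2 * cos k /\
  sin (end_heading rho h legs) = sg * sin k.
Proof.
have ssg := sign_sqr sgs; have ss2 := sign_sqr s2s.
have [C S] := last_heading; have sm := sign_mul sgs s2s.
have rn : rho != 0 by rewrite gt_eqF.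
have -> : end_heading rho h legs = h3 + (sg * s2) * (k + pi / 2) + sg * m.
  transitivity (h3 + (sg * s2) * (k + pi / 2) + sg * (s2 * s2) * m).
    by rewrite /= /h3 /h2 /h1; field.
  by rewrite ss2 mulr1.
have E := sin2cos2 m.
rewrite (cosD_sign _ m sgs) (sinD_sign _ m sgs).
rewrite (cosD_sign h3 _ sm) (sinD_sign h3 _ sm).
rewrite C S cosDpihalf sinDpihalf; split; ring: E ssg ss2.
Qed.

Let turns (phi : R) : advance rho (h - phi) legs =
  rho * (sg * s1) * (sin (h1 - phi) - sin (h - phi)) + d1 * cos (h1 - phi)
  + rho * - sg * (sin (h2 - phi) - sin (h1 - phi)) + d2 * cos (h2 - phi)
  + rho * - sg * (sin (h3 - phi) - sin (h2 - phi)) + d3 * cos (h3 - phi)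
  + rho * (sg * s2) * (sin (h4 - phi) - sin (h3 - phi)).
Proof.
have sN : is_sign (- sg) by case: sgs => ->; rewrite /is_sign ?opprK; auto.
have rn : rho != 0 by rewrite gt_eqF.
have dv a c : c * (rho * a) / rho = c * a by field.
have sh a b : a - phi + b = a + b - phi by ring.
have z l : 0 * l / rho = 0 by rewrite mul0r mul0r.
rewrite /= !leg_advance_turn ?leg_advance_straight;
  try exact: sign_mul; try by [].
rewrite !dv !z !addr0 !sh -/h1 -/h2 -/h3 -/h4; ring.
Qed.

(** Along the line of sight each s = 1 arc gains up to 2 rho and each s = -1 arc
    loses as much, while the middle arcs gain 2 rho cos m. *)
Lemma detour_along : advance rho h legs =
  rho * (s1 * (cos m - sin i) + 2 * cos m + s2 * (cos m + sin k))
  + d2 - (d1 + d3) * sin m.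
Proof.
have [[C1 S1] [C2 S2] [C3 S3]] :=
  And3 first_heading middle_heading last_heading.
have [_ S4] := detour_heading.
have ssg := sign_sqr sgs.
have S0 : sin h = sg * sin i by rewrite sin_i mulrA ssg mul1r.
have e4 : sin h4 = sg * sin k.
  rewrite -S4 /=; congr sin; rewrite /h4 /h3 /h2 /h1; field.
  by rewrite gt_eqF.
have := turns 0; rewrite !subr0 => ->.
rewrite C1 S1 C2 S2 C3 S3 e4 S0; ring: ssg.
Qed.

Lemma detour_across : advance rho (h - pi / 2) legs =
  sg * (rho * (cos i - cos k + (s1 - s2) * sin m) + (d1 - d3) * cos m).
Proof.
have [[C1 S1] [C2 S2] [C3 S3]] :=
  And3 first_heading middle_heading last_heading.
have [C4 _] := detour_heading.
have ssg := sign_sqr sgs; have ss1 := sign_sqr s1s; have ss2 := sign_sqr s2s.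
have e4 : cos h4 = s2 * cos k.
  rewrite -C4 /=; congr cos; rewrite /h4 /h3 /h2 /h1; field.
  by rewrite gt_eqF.
rewrite turns !sinBpihalf !cosBpihalf C1 S1 C2 S2 C3 S3 e4 -cos_i.
ring: ss1 ss2.
Qed.

End DetourEndpoint.
End Detour.

Section EarlyArrival.
Variables (R : realType) (rho : R).
Hypothesis rho_gt0 : 0 < rho.

(** Mirroring exchanges the order of sin h and sin g, so sg can be chosen to put
    the folded initial angle i above the folded final angle k.  This inequality
    is what keeps the arcs of the detour within the length 2 pi rho. *)
Lemma folded_pair (h g : R) : exists (sg s1 s2 i k : R),
  [/\ is_sign sg, is_sign s1 & is_sign s2] /\
  [/\ - (pi / 2) <= k, k <= i & i <= pi / 2] /\
  [/\ sin i = sg * sin h, s1 * cos i = cos h,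
      sin k = sg * sin g & s2 * cos k = cos g].
Proof.
have [sg [sgs le_sg]] : exists sg : R, is_sign sg /\ sg * sin g <= sg * sin h.
  have [gh|hg] := leP (sin g) (sin h).
    by exists 1; rewrite !mul1r; split=> //; left.
  by exists (-1); rewrite !mulN1r lerN2 ltW//; split=> //; right.
have sinM x : sin (sg * x) = sg * sin x.
  by case: sgs => ->; rewrite ?mul1r// !mulN1r sinN.
have cosM x : cos (sg * x) = cos x.
  by case: sgs => ->; rewrite ?mul1r// !mulN1r cosN.
have [i [s1 [s1s iI si ci]]] := folded_angle (sg * h).
have [k [s2 [s2s kI sk ck]]] := folded_angle (sg * g).
exists sg, s1, s2, i, k; rewrite si ci sk ck !sinM !cosM.
have ki : k <= i.
  rewrite leNgt -ltr_sin ?in_itv//= -leNgt si sk !sinM//.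
by split=> //; split=> //; split=> //; lra.
Qed.

(** With m = 0 the arcs have length rho (2 pi - (i - k)), they advance along the
    line of sight by rho w with 0 <= w <= 4, and across it by
    rho (cos i - cos k), which is at most rho (i - k) in absolute value.  So the
    middle segment must have length Q - rho w, and what remains for the two
    perpendicular segments exceeds the required difference of their lengths.
    This works unless Q = 4 rho and w = 4, where the middle segment vanishes. *)
Lemma detour_exists (h g Q L : R) : 4 * rho <= Q -> 2 * pi * rho + Q < L ->
  exists (sg s1 s2 m i k d1 d2 d3 : R),
  [/\ is_sign sg, is_sign s1 & is_sign s2] /\
  [/\ 0 <= pi / 2 - i + s1 * m, 0 <= pi / 2 + m, 0 <= k + pi / 2 + s2 * m,
      0 <= sin m & 0 < cos m] /\
  [/\ sin i = sg * sin h, s1 * cos i = cos h,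
      sin k = sg * sin g & s2 * cos k = cos g] /\
  [/\ 0 < d1, 0 < d2 & 0 < d3] /\
  [/\ rho * (2 * pi - (i - k) + (2 + s1 + s2) * m) + d1 + d2 + d3 = L,
      rho * (s1 * (cos m - sin i) + 2 * cos m + s2 * (cos m + sin k))
        + d2 - (d1 + d3) * sin m = Q &
      rho * (cos i - cos k + (s1 - s2) * sin m) + (d1 - d3) * cos m = 0].
Proof.
move=> Q4 QL; have pi2 := pi_ge2 R.
have [sg [s1 [s2 [i [k [[sgs s1s s2s] [[kl ki il] [si ci sk ck]]]]]]]] :=
  folded_pair h g.
have := sin_le1 i; have := sin_geN1 k => sk1 si1.
have ski : sin k <= sin i.
  have [->|ne] := eqVneq k i; first by [].
  by rewrite ltW// ltr_sin ?in_itv/=; lra.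
have w1 : - (1 - sin i) <= s1 * (1 - sin i) <= 1 - sin i.
  by case: s1s => ->; lra.
have w2 : - (1 + sin k) <= s2 * (1 + sin k) <= 1 + sin k.
  by case: s2s => ->; lra.
pose w := s1 * (1 - sin i) + 2 + s2 * (1 + sin k).
have w0 : 0 <= w by rewrite /w; lra.
have w4 : w <= 4 by rewrite /w; lra.
have [p0|p0] := ltP (rho * w) Q.
  have Clip : `|rho * (cos k - cos i)| <= rho * (i - k).
    rewrite normrM gtr0_norm// ler_pM2l// (le_trans (ler_cosB _ _))//.
    by rewrite distrC ger0_norm ?subr_ge0.
  have rw : 0 <= rho * w by rewrite mulr_ge0// ltW.
  pose D := L - rho * (2 * pi - (i - k)) - (Q - rho * w).
  have DE : rho * (i - k) < D by rewrite /D; move: rw QL; lra.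
  move: Clip; rewrite ler_norml => /andP[C1 C2].
  exists sg, s1, s2, 0, i, k, ((D + rho * (cos k - cos i)) / 2), (Q - rho * w),
    ((D - rho * (cos k - cos i)) / 2).
  rewrite sin0 cos0; refine (conj _ (conj _ (conj _ (conj _ _)))); split=> //.
  all: rewrite ?mulr0 ?addr0; try lra.
  - by rewrite /D; field.
  - by rewrite /w; ring.
(* In the exceptional case initial and final headings agree up to 2 pi and do
   not point backwards.  Turning slightly beyond the perpendicular, by an angle
   m > 0 with 1 - cos m <= m < 1 - m, makes room for a middle segment. *)
have Qw : rho * w <= rho * 4 by rewrite ler_pM2l.
have Q4' : Q = 4 * rho by apply/eqP; rewrite eq_le Q4; lra.
have w4' : w = 4.
  by apply/eqP; rewrite eq_le w4 -(ler_pM2l rho_gt0); lra.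
have sik : sin i = sin k by move: w4'; rewrite /w; lra.
have ik : i = k.
  by apply: sin_inj => //; rewrite in_itv/=; lra.
have ci1 : cos i = cos h.
  case: (s1s) => s1E; first by rewrite -ci s1E mul1r.
  have s1' : sin i = 1 by move: w4'; rewrite /w s1E; lra.
  have c0 : cos i = 0 by apply/eqP; rewrite -sqrf_eq0 cos2sin2 s1' expr1n subrr.
  by rewrite -ci c0 mulr0.
have ck1 : cos k = cos g.
  case: (s2s) => s2E; first by rewrite -ck s2E mul1r.
  have s2' : sin k = -1 by move: w4'; rewrite /w s2E; lra.
  have c0 : cos k = 0.
    by apply/eqP; rewrite -sqrf_eq0 cos2sin2 s2' sqrrN expr1n subrr.
  by rewrite -ck c0 mulr0.
pose m : R := 4^-1.
have m0 : 0 < m by rewrite invr_gt0.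
have m1 : m = 1 / 4 by rewrite /m mul1r.
have sm : 0 < sin m by apply: sin2_gt0; lra.
have cm : 1 - cos m <= 1 / 4.
  have := ler_cosB 0 m; rewrite cos0 sub0r normrN (gtr0_norm m0) -m1.
  by apply: le_trans; exact: ler_norm.
pose W := L - rho * (2 * pi + 1).
pose s := (W - 4 * rho * (1 - cos m)) / (2 * (1 + sin m)).
have sE : 2 * s * (1 + sin m) = W - 4 * rho * (1 - cos m).
  rewrite /s; field; lra.
have rc : rho * (1 - cos m) <= rho * (1 / 4) by rewrite ler_pM2l.
have rp : rho * (1 - cos m) >= 0.
  by rewrite mulr_ge0 ?subr_ge0 ?cos_le1// ltW.
have s0 : 0 < s.
  rewrite divr_gt0//; last lra.
  by rewrite /W; lra.
have ssm : 0 < s * sin m by rewrite mulr_gt0.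
exists sg, 1, 1, m, i, k, s, (4 * rho * (1 - cos m) + 2 * s * sin m), s.
refine (conj _ (conj _ (conj _ (conj _ _)))); split=> //.
all: try by [left|lra|rewrite mul1r|rewrite mul1r; lra].
- by move: sE; rewrite -ik subrr /W m1; lra.
- by rewrite -ik Q4'; ring.
- by rewrite -ik; ring.
Qed.


Lemma small_step (d1 d2 d3 k1 k2 k3 : R) : 0 < d1 -> 0 < d2 -> 0 < d3 ->
  exists e : R, [/\ 0 < e, 0 < d1 - e * k1, 0 < d2 - e * k2 & 0 < d3 - e * k3].
Proof.
move=> p1 p2 p3.
pose m := Num.min d1 (Num.min d2 d3).
have m0 : 0 < m by rewrite !lt_min p1 p2 p3.
have N0 : 0 < 1 + `|k1| + `|k2| + `|k3|.
  by rewrite !ltr_pwDl.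
pose e := m / (1 + `|k1| + `|k2| + `|k3|).
have e0 : 0 < e by rewrite divr_gt0.
have eE : e * (1 + `|k1| + `|k2| + `|k3|) = m by rewrite /e divfK// gt_eqF.
have step d k : m <= d -> `|k| <= `|k1| + `|k2| + `|k3| -> 0 < d - e * k.
  move=> md kN; rewrite subr_gt0 (lt_le_trans _ md)// -eE ltr_pM2l//.
  by have := ler_norm k; lra.
have := normr_ge0 k1; have := normr_ge0 k2; have := normr_ge0 k3 => n3 n2 n1.
by exists e; split=> //; apply: step; rewrite /m ?ge_min ?lexx ?orbT//; lra.
Qed.

(** Shortening the segments by e k1, e k2, e k3 changes the end point and
    the length linearly.  As the three headings are those of an isosceles
    triangle inscribed in the unit circle, the k's can be taken as the
    barycentric coordinates of (v1, v2): then the length decreases by e and the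
    end point moves by - e (v1, v2).  The lengths stay positive for small e. *)
Lemma early_legs (h g Q L v1 v2 : R) : 4 * rho <= Q -> 2 * pi * rho + Q < L ->
  exists (e : R) (legs : seq (R * R)),
  [/\ 0 < e, all (@valid_leg R) legs, 0 < path_length legs &
      path_length legs = L - e] /\
  [/\ advance rho h legs = Q - e * v1,
      advance rho (h - pi / 2) legs = - (e * v2),
      cos (end_heading rho h legs) = cos g &
      sin (end_heading rho h legs) = sin g].
Proof.
move=> Q4 QL.
have [sg [s1 [s2 [m [i [k [d1 [d2 [d3]]]]]]]]] := detour_exists h g Q4 QL.
move=> [[sgs s1s s2s] [[a1 a0 a2 sm cm]
  [[si ci sk ck] [[p1 p2 p3] [lE alE acE]]]]].
have ssg := sign_sqr sgs.
pose kd := sg * v2 / cos m.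
pose ks := (1 - v1) / (1 + sin m).
pose k2 := (v1 + sin m) / (1 + sin m).
have sm1 : 1 + sin m != 0 by rewrite gt_eqF//; lra.
have [e [e0 q1 q2 q3]] :=
  small_step ((ks + kd) / 2) k2 ((ks - kd) / 2) p1 p2 p3.
pose e1 := d1 - e * ((ks + kd) / 2).
pose e2 := d2 - e * k2.
pose e3 := d3 - e * ((ks - kd) / 2).
exists e, (detour rho sg s1 s2 m i k e1 e2 e3).
have sgv s : is_sign s -> -1 <= s <= 1 by case=> ->; rewrite ?lexx ?lerN10; lra.
have ksum : ks + k2 = 1 by rewrite /ks /k2; field.
have kal : k2 - ks * sin m = v1 by rewrite /ks /k2; field.
have kac : sg * (kd * cos m) = v2.
  by rewrite /kd divfK ?gt_eqF// mulrA ssg mul1r.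
have [hc hs] :=
  @detour_heading _ _ rho_gt0 _ _ _ m _ k e1 e2 e3 _ sgs s1s s2s si ci.
have plE : path_length (detour rho sg s1 s2 m i k e1 e2 e3) = L - e.
  have ek : e * ks + e * k2 = e by rewrite -mulrDr ksum mulr1.
  by rewrite detour_length /e1 /e2 /e3; lra.
split; split=> //.
- have vS c a : is_sign c -> 0 <= a -> valid_leg (c, rho * a).
    by move=> sc a0'; rewrite /valid_leg/= sgv// mulr_ge0// ltW.
  have v0 l : 0 < l -> valid_leg (0, l).
    by move=> l0; rewrite /valid_leg/= lerN10 ler01 ltW.
  have sN : is_sign (- sg) by case: sgs => ->; rewrite /is_sign ?opprK; auto.
  by rewrite /= !vS ?v0//; exact: sign_mul.
- have r0 := ltW rho_gt0.
  have := mulr_ge0 r0 a1; have := mulr_ge0 r0 a0; have := mulr_ge0 r0 a2.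
  by rewrite /= -/e1 -/e2 -/e3 in q1 q2 q3 *; lra.
- rewrite (@detour_along _ _ rho_gt0 _ _ _ m _ k e1 e2 e3 _ sgs s1s s2s si ci).
  rewrite -alE -kal /e1 /e2 /e3.
  by field.
- rewrite (@detour_across _ _ rho_gt0 _ _ _ m _ k e1 e2 e3 _ sgs s1s s2s si ci).
  rewrite -kac.
  transitivity (sg * (rho * (cos i - cos k + (s1 - s2) * sin m)
      + (d1 - d3) * cos m) - e * (sg * (kd * cos m))).
    by rewrite /e1 /e2 /e3; field.
  by rewrite acE mulr0 add0r.
- by rewrite hc.
- by rewrite hs sk mulrA ssg mul1r.
Qed.

End EarlyArrival.

(** * Optimal paths have no superfluous loop *)

Section Optimal.
Variables (R : realType) (VP rho VT thT x0 y0 phif tf : R) (u x y th : R -> R).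
Hypotheses (VP_gt0 : 0 < VP) (rho_gt0 : 0 < rho).
Hypothesis opt : OCP_solution VP rho VT thT x0 y0 phif tf u x y th.
Local Notation range := (Num.sqrt (x tf ^+ 2 + y tf ^+ 2)).
Hypothesis far : 4 * rho <= range.

(** Otherwise [early_legs], applied in the frame of the line of sight with the
    velocity of the target, gives a path that meets the target at the time
    tf - e / VP with the same final heading. *)
Lemma optimal_length_bound : VP * tf <= 2 * pi * rho + range.
Proof.
rewrite leNgt; apply/negP => long.
have [[tf0 ua tr [xE yE] [k0 hE]] best] := opt.
have [t [xt yt]] := polar_form (x tf) (y tf).
pose vx := VT / VP * cos thT; pose vy := VT / VP * sin thT.
have [e [legs [[e0 al lp lE] [aE bE cE sE]]]] := early_legs rho_gt0 (pi / 2 - t)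
  (th tf - t) (vx * cos t + vy * sin t) (vy * cos t - vx * sin t) far long.
have [u' [x' [y' [th' [ua' tr' thE' xE' yE']]]]] :=
  legs_trajectory VP_gt0 rho_gt0 al.
set tf' := path_length legs / VP in ua' tr' thE' xE' yE'.
have tfE : tf' = tf - e / VP.
  by rewrite /tf' lE; field; rewrite gt_eqF.
have E := sin2cos2 t.
suff : tf <= tf'.
  by rewrite tfE lerDl oppr_ge0 leNgt divr_gt0.
apply: (best tf' u' x' y' th'); split=> //.
- exact: divr_gt0.
- rewrite xE' yE' /target_x /target_y tfE.
  have := advance_rotate rho (pi / 2 - t) (pi / 2 - t) legs.
  have := advance_rotate rho (pi / 2 - t) (- t) legs.
  rewrite opprK subrK subrr aE bE => -> ->.
  rewrite cosN sinN cosB sinB cos_pihalf sin_pihalf.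
  rewrite /target_x in xE; rewrite /target_y in yE.
  split.
    transitivity (x tf - e * vx); first by rewrite [in RHS]xt; ring: E.
    by rewrite xE /vx; ring.
  transitivity (y tf - e * vy); first by rewrite [in RHS]yt; ring: E.
  by rewrite yE /vy; ring.
- have : eq_angle (end_heading rho (pi / 2 - t) legs) (th tf - t).
    exact/eq_angleP.
  case=> k1 h1; exists (k0 + k1).
  rewrite thE'; have -> : pi / 2 = (pi / 2 - t) + t :> R by rewrite subrK.
  rewrite end_heading_shift h1 intrD.
  by move: hE; lra.
Qed.

Variables (c1 c2 : turn) (alpha d beta gamma : R).
Hypothesis path : CSC_path VP rho tf u th c1 c2 alpha d beta gamma.
Local Notation s1 := (turn_control R c1).
Local Notation s2 := (turn_control R c2).
Local Notation b := (pi / 2 + s1 * alpha).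
Local Notation f := (pi / 2 + s1 * alpha + s2 * gamma).

Lemma CSC_endpoint :
  [/\ eq_angle b beta, eq_angle (f - thT) phif,
      VP * tf = rho * (alpha + gamma) + d,
      x tf = rho * s1 * (sin b - 1) + d * cos b + rho * s2 * (sin f - sin b) &
      y tf = - (rho * s1 * cos b) + d * sin b - rho * s2 * (cos f - cos b)].
Proof.
have [[tf0 ua tr _ hE] _] := opt.
have [[a0 d0 g0 _] [tfE u1 u2 u3 thb]] := path.
have ra : 0 <= rho * alpha by rewrite mulr_ge0// ltW.
have rg : 0 <= rho * gamma by rewrite mulr_ge0// ltW.
have Vn : VP != 0 by rewrite gt_eqF.
have rn : rho != 0 by rewrite gt_eqF.
pose legs : seq (R * R) := [:: (s1, rho * alpha); (0, d); (s2, rho * gamma)].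
have fl : follows_legs VP u 0 legs.
  rewrite /= add0r -!mulrDl -tfE; split=> //.
have tfl : tf = path_length legs / VP by rewrite tfE /= addr0 addrA.
have [thE xE yE] := trajectory_endpoint VP_gt0 rho_gt0 ua tr fl tfl.
have dv a c : c * (rho * a) / rho = c * a by field.
have z l : 0 * l / rho = 0 :> R by rewrite mul0r mul0r.
have fE : th tf = f by rewrite thE /= z !dv addr0.
have bE : th (rho * alpha / VP) = b.
  have th0 : th 0 = pi / 2.
    have [_ _ ->] := tr 0 ltac:(lra).
    by rewrite set_itv1 Rintegral_set1 addr0.
  rewrite (heading_on_leg (VP := VP) (rho := rho) ua tr (lexx 0) _
    (lexx _) _ u1).
  - by rewrite th0; congr (_ + _); field; rewrite rn Vn.
  - by rewrite divr_ge0// ltW.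
  - by rewrite tfE ler_pM2r ?invr_gt0//; lra.
split.
- by rewrite -bE.
- by rewrite -fE.
- by rewrite tfE; field.
- rewrite xE /= !leg_advance_turn ?leg_advance_straight//;
    try exact: turn_control_sign.
  by rewrite z !dv !addr0 sin_pihalf; ring.
- rewrite yE /= !leg_advance_turn ?leg_advance_straight//;
    try exact: turn_control_sign.
  rewrite z !dv !addr0 !add0r sin0.
  have -> : sin (s1 * alpha) = - cos b
    by rewrite -sinBpihalf addrC addrA addNr add0r.
  have -> : cos (s1 * alpha) = sin b
    by rewrite -cosBpihalf addrC addrA addNr add0r.
  have -> : sin (s1 * alpha + s2 * gamma) = - cos f.
    by rewrite -sinBpihalf; congr sin; ring.
  by ring.
Qed.

(** The distance covered is the displacement projected on the line of sight, to
    which each of the three pieces contributes separately. *)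
Lemma CSC_range : exists t, range =
  rho * (s1 * (sin (pi / 2 - t + s1 * alpha) - sin (pi / 2 - t))) +
  d * cos (b - t) +
  rho * (s2 * (sin (b - t + s2 * gamma) - sin (b - t))).
Proof.
have [t [xt yt]] := polar_form (x tf) (y tf); exists t.
have E := sin2cos2 t; have [_ _ _ xE yE] := CSC_endpoint.
transitivity (x tf * cos t + y tf * sin t).
  by set r := Num.sqrt _ in xt yt *; rewrite xt yt; ring: E.
have -> : pi / 2 - t + s1 * alpha = b - t by ring.
have -> : b - t + s2 * gamma = f - t by ring.
rewrite xE yE !sinB cosB cos_pihalf sin_pihalf; ring.
Qed.

Lemma CSC_no_loop : alpha <= 2 * pi /\ gamma <= 2 * pi.
Proof.
have [[a0 d0 g0 _] _] := path; have [t rE] := CSC_range.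
have [_ _ LE _ _] := CSC_endpoint.
have := optimal_length_bound; rewrite rE LE => long.
have dc : d * cos (b - t) <= d by rewrite ler_piMr// cos_le1.
have sg c : is_sign (turn_control R c) by exact: turn_control_sign.
split; rewrite leNgt; apply/negP => loop.
- have : rho * (s1 * (sin (pi / 2 - t + s1 * alpha) - sin (pi / 2 - t))) <
    rho * (alpha - 2 * pi) by rewrite ltr_pM2l// excess_turn.
  have : rho * (s2 * (sin (b - t + s2 * gamma) - sin (b - t))) <= rho * gamma.
    by rewrite ler_pM2l// turn_advance_le.
  lra.
- have : rho * (s1 * (sin (pi / 2 - t + s1 * alpha) - sin (pi / 2 - t))) <=
    rho * alpha by rewrite ler_pM2l// turn_advance_le.
  have : rho * (s2 * (sin (b - t + s2 * gamma) - sin (b - t))) <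
    rho * (gamma - 2 * pi) by rewrite ltr_pM2l// excess_turn.
  lra.
Qed.

(** Two parallel arcs advance like a single arc of angle alpha + gamma, because
    the heading is the same at the end of the first and at the beginning of the
    second. *)
Lemma CSC_same_turn : c1 = c2 -> alpha + gamma <= 2 * pi.
Proof.
move=> cc; have [[a0 d0 g0 _] _] := path; have [t rE] := CSC_range.
have [_ _ LE _ _] := CSC_endpoint.
have := optimal_length_bound; rewrite rE LE -cc => long.
have dc : d * cos (b - t) <= d by rewrite ler_piMr// cos_le1.
rewrite leNgt; apply/negP => loop.
have : rho * (s1 * (sin (pi / 2 - t + s1 * (alpha + gamma))
      - sin (pi / 2 - t))) <
    rho * (alpha + gamma - 2 * pi).
  by rewrite ltr_pM2l// excess_turn//; exact: turn_control_sign.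
have -> : pi / 2 - t + s1 * (alpha + gamma) = b - t + s1 * gamma by ring.
move: long; have -> : pi / 2 - t + s1 * alpha = b - t by ring.
lra.
Qed.

End Optimal.

(** * The integer n *)

Lemma final_heading_spec (R : realType) (phif thT : R) :
  0 <= thT <= 2 * pi -> 0 <= phif < 2 * pi ->
  0 <= final_heading phif thT < 2 * pi /\
  eq_angle (phif + thT) (final_heading phif thT).
Proof.
rewrite /final_heading => hT hp; case: ltP => h.
  by split; [lra|exists 0; rewrite mul0r addr0].
by split; [lra|exists 1; rewrite mul1r subrK].
Qed.

Section TurnCount.
Variables (R : realType) (thf beta alpha gamma : R) (n : int).
Hypothesis thf_range : 0 <= thf < 2 * pi.
Hypothesis beta_range : 0 <= beta < 2 * pi.
Hypotheses (alpha_ge0 : 0 <= alpha) (gamma_ge0 : 0 <= gamma).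

(** The bound 2 pi on the total turning leaves a single possible number of full
    turns, except that a total of 0 and of 2 pi are congruent; n is specified
    separately for these. *)
Lemma RR_turning : eq_angle (pi / 2 - (alpha + gamma)) thf ->
  alpha + gamma <= 2 * pi -> n_RR thf alpha gamma n ->
  alpha + gamma = pi / 2 - thf + 2 * n%:~R * pi.
Proof.
have pi0 := pi_gt0 R; have a0 := alpha_ge0; have g0 := gamma_ge0.
move: thf_range => /andP[t0 t1]; rewrite /n_RR /theta0 => -[k kE] A2 hn.
suff nk : - k = n by move: kE; rewrite -nk mulrNz; lra.
have kN : (- k)%:~R * (2 * pi) = - (k%:~R * (2 * pi)) :> R
  by rewrite mulrNz mulNr.
apply: (@int_turns R); rewrite kN;
  case: hn => [[-> [h|h]]|[-> [h1 h2]]]; rewrite ?mulr0z ?mulr1z; lra.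
Qed.

Lemma LL_turning : eq_angle (pi / 2 + (alpha + gamma)) thf ->
  alpha + gamma <= 2 * pi -> n_LL thf alpha gamma n ->
  alpha + gamma = thf - pi / 2 + 2 * n%:~R * pi.
Proof.
have pi0 := pi_gt0 R; have a0 := alpha_ge0; have g0 := gamma_ge0.
move: thf_range => /andP[t0 t1]; rewrite /n_LL /theta0 => -[k kE] A2 hn.
suff nk : k = n by move: kE; rewrite -nk; lra.
apply: (@int_turns R);
  case: hn => [[-> [h|h]]|[-> [h1 h2]]]; rewrite ?mulr0z ?mulr1z; lra.
Qed.

(** Angles of [0, 2 pi] congruent to t are t itself or t + 2 pi according to the
    sign of t.  For turns in opposite senses this applies to each arc; the two
    counts add up to n. *)
Lemma opposite_turns (k l : int) (s t : R) : 0 <= s -> s <= 2 * pi ->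
  s = t + k%:~R * (2 * pi) -> - (2 * pi) < t < 2 * pi ->
  (0 < t -> k = 0) /\ (t < 0 -> k = 1).
Proof.
move=> s0 s2 sE /andP[t1 t2].
by split=> ht; apply: (@int_turns R); rewrite ?mulr0z ?mulr1z; lra.
Qed.

Lemma RL_turning : eq_angle (pi / 2 - alpha) beta ->
  eq_angle (pi / 2 - alpha + gamma) thf ->
  alpha <= 2 * pi -> gamma <= 2 * pi -> n_RL thf beta n ->
  alpha + gamma = pi / 2 + thf - 2 * beta + 2 * n%:~R * pi.
Proof.
have pi0 := pi_gt0 R; have a0 := alpha_ge0; have g0 := gamma_ge0.
move: thf_range beta_range => /andP[t0 t1] /andP[b0 b1].
rewrite /n_RL /theta0 => -[k kE] [l lE] a2 g2 hn.
have [ka1 ka2] : (0 < pi / 2 - beta -> - k = 0) /\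
    (pi / 2 - beta < 0 -> - k = 1).
  by apply: (@opposite_turns _ 0 alpha); rewrite ?mulrNz; lra.
have [kg1 kg2] : (0 < thf - beta -> l - k = 0) /\ (thf - beta < 0 -> l - k = 1).
  by apply: (@opposite_turns _ 0 gamma); rewrite ?intrB; lra.
suff nk : - k + (l - k) = n.
  by move: kE lE; rewrite -nk !intrD !mulrNz; lra.
case: hn => [[-> [h1 h2]]|[-> h]|[-> [h1 h2]]].
- by rewrite kg1 ?ka1//; lra.
- have [h1|h1|h1] := ltgtP (pi / 2 - beta) 0.
  + by rewrite nmulr_rlt0// in h; rewrite kg1 ?ka2.
  + by rewrite pmulr_rlt0// in h; rewrite kg2 ?ka1.
  + by move: h; rewrite h1 mul0r ltxx.
- by rewrite kg2 ?ka2//; lra.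
Qed.

Lemma LR_turning : eq_angle (pi / 2 + alpha) beta ->
  eq_angle (pi / 2 + alpha - gamma) thf ->
  alpha <= 2 * pi -> gamma <= 2 * pi -> n_LR thf beta n ->
  alpha + gamma = 2 * beta - pi / 2 - thf - 2 * n%:~R * pi.
Proof.
have pi0 := pi_gt0 R; have a0 := alpha_ge0; have g0 := gamma_ge0.
move: thf_range beta_range => /andP[t0 t1] /andP[b0 b1].
rewrite /n_LR /theta0 => -[k kE] [l lE] a2 g2 hn.
have [ka1 ka2] : (0 < beta - pi / 2 -> k = 0) /\ (beta - pi / 2 < 0 -> k = 1).
  by apply: (@opposite_turns _ 0 alpha); lra.
have [kg1 kg2] : (0 < beta - thf -> k - l = 0) /\ (beta - thf < 0 -> k - l = 1).
  by apply: (@opposite_turns _ 0 gamma); rewrite ?intrB; lra.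
suff nk : - (k + (k - l)) = n.
  by move: kE lE; rewrite -nk mulrNz !intrD !mulrNz; lra.
case: hn => [[-> [h1 h2]]|[-> h]|[-> [h1 h2]]].
- by rewrite kg1 ?ka1//; lra.
- have [h1|h1|h1] := ltgtP (pi / 2 - beta) 0.
  + by rewrite nmulr_rlt0// in h; rewrite kg2 ?ka1//; lra.
  + by rewrite pmulr_rlt0// in h; rewrite kg1 ?ka2//; lra.
  + by move: h; rewrite h1 mul0r ltxx.
- by rewrite kg2 ?ka2//; lra.
Qed.

End TurnCount.

(** * Elimination of the segment length *)

Section Equations.
Variables (R : realType) (rho x0 y0 vx vy thf beta d A : R) (n : int).
Hypothesis vx_neq0 : vx <> 0.
Let vxn : vx != 0. Proof. exact/eqP. Qed.

Lemma RR_equation :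
  A = pi / 2 - thf + 2 * n%:~R * pi ->
  x0 + vx * (rho * A + d) = rho * (1 - sin thf) + d * cos beta ->
  y0 + vy * (rho * A + d) = rho * cos thf + d * sin beta ->
  RR_a1 rho x0 y0 vx vy thf
  + RR_a2 rho x0 vx thf n * sin beta
  + RR_a3 rho x0 y0 vx vy thf n * cos beta = 0.
Proof.
move=> AE xE yE.
have {xE} -> : x0 = rho * (1 - sin thf) + d * cos beta - vx * (rho * A + d).
  by rewrite -xE addrK.
have {yE} -> : y0 = rho * cos thf + d * sin beta - vy * (rho * A + d).
  by rewrite -yE addrK.
by rewrite /RR_a1 /RR_a2 /RR_a3 /theta0 -AE; field.
Qed.

Lemma LL_equation :
  A = thf - pi / 2 + 2 * n%:~R * pi ->
  x0 + vx * (rho * A + d) = rho * (sin thf - 1) + d * cos beta ->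
  y0 + vy * (rho * A + d) = - (rho * cos thf) + d * sin beta ->
  LL_b1 rho x0 y0 vx vy thf
  + LL_b2 rho x0 vx thf n * sin beta
  + LL_b3 rho x0 y0 vx vy thf n * cos beta = 0.
Proof.
move=> AE xE yE.
have {xE} -> : x0 = rho * (sin thf - 1) + d * cos beta - vx * (rho * A + d).
  by rewrite -xE addrK.
have {yE} -> : y0 = - (rho * cos thf) + d * sin beta - vy * (rho * A + d).
  by rewrite -yE addrK.
by rewrite /LL_b1 /LL_b2 /LL_b3 /theta0 -AE; field.
Qed.

Lemma RL_equation :
  A = pi / 2 + thf - 2 * beta + 2 * n%:~R * pi ->
  x0 + vx * (rho * A + d) =
    rho * (1 + sin thf - 2 * sin beta) + d * cos beta ->
  y0 + vy * (rho * A + d) =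
    rho * (2 * cos beta - cos thf) + d * sin beta ->
  RL_c1 rho x0 y0 vx vy thf
  + RL_c2 rho x0 vx vy thf n * sin beta
  + RL_c3 rho x0 y0 vx vy thf n * cos beta
  + beta * (RL_c4 rho vx * sin beta + RL_c5 rho vy * cos beta) = 0.
Proof.
move=> AE xE yE; have E := sin2cos2 beta.
have {xE} -> : x0 = rho * (1 + sin thf - 2 * sin beta) + d * cos beta
    - vx * (rho * A + d) by rewrite -xE addrK.
have {yE} -> : y0 = rho * (2 * cos beta - cos thf) + d * sin beta
    - vy * (rho * A + d) by rewrite -yE addrK.
rewrite /RL_c1 /RL_c2 /RL_c3 /RL_c4 /RL_c5 /theta0.
have -> : pi / 2 + thf + 2 * n%:~R * pi = A + 2 * beta by rewrite AE; ring.
by field: E.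
Qed.

Lemma LR_equation :
  A = 2 * beta - pi / 2 - thf - 2 * n%:~R * pi ->
  x0 + vx * (rho * A + d) =
    rho * (2 * sin beta - 1 - sin thf) + d * cos beta ->
  y0 + vy * (rho * A + d) =
    rho * (cos thf - 2 * cos beta) + d * sin beta ->
  LR_d1 rho x0 y0 vx vy thf
  + LR_d2 rho x0 vx vy thf n * sin beta
  + LR_d3 rho x0 y0 vx vy thf n * cos beta
  + beta * (LR_d4 rho vx * sin beta + LR_d5 rho vy * cos beta) = 0.
Proof.
move=> AE xE yE; have E := sin2cos2 beta.
have {xE} -> : x0 = rho * (2 * sin beta - 1 - sin thf) + d * cos beta
    - vx * (rho * A + d) by rewrite -xE addrK.
have {yE} -> : y0 = rho * (cos thf - 2 * cos beta) + d * sin beta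
    - vy * (rho * A + d) by rewrite -yE addrK.
rewrite /LR_d1 /LR_d2 /LR_d3 /LR_d4 /LR_d5 /theta0.
have -> : pi / 2 + thf + 2 * n%:~R * pi = 2 * beta - A by rewrite AE; ring.
by field: E.
Qed.

End Equations.

Section Interception.
Variables (R : realType) (VP rho VT thT x0 y0 phif tf : R) (u x y th : R -> R).
Variables (c1 c2 : turn) (alpha d beta gamma : R).
Hypotheses (VP_gt0 : 0 < VP) (rho_gt0 : 0 < rho).
Hypotheses (thT_range : 0 <= thT <= 2 * pi) (phif_range : 0 <= phif < 2 * pi).
Hypothesis opt : OCP_solution VP rho VT thT x0 y0 phif tf u x y th.
Hypothesis path : CSC_path VP rho tf u th c1 c2 alpha d beta gamma.
Local Notation s1 := (turn_control R c1).
Local Notation s2 := (turn_control R c2).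
Local Notation thf := (final_heading phif thT).

Lemma CSC_interception :
  [/\ eq_angle (pi / 2 + s1 * alpha) beta,
      eq_angle (pi / 2 + s1 * alpha + s2 * gamma) thf,
      x0 + VT / VP * cos thT * (rho * (alpha + gamma) + d) =
        rho * s1 * (sin beta - 1) + d * cos beta
        + rho * s2 * (sin thf - sin beta) &
      y0 + VT / VP * sin thT * (rho * (alpha + gamma) + d) =
        - (rho * s1 * cos beta) + d * sin beta
        - rho * s2 * (cos thf - cos beta)].
Proof.
have [bA [k1 fA] LE xE yE] := CSC_endpoint VP_gt0 rho_gt0 opt path.
have [_ [k2 hE]] := final_heading_spec thT_range phif_range.
have [[_ _ _ [xT yT] _] _] := opt.
have fE : eq_angle (pi / 2 + s1 * alpha + s2 * gamma) thf.
  by exists (k1 + k2); rewrite intrD; move: fA hE; lra.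
have [cb sb] := (eq_angleP _ _).1 bA; have [cf sf] := (eq_angleP _ _).1 fE.
have Vn : VP != 0 by rewrite gt_eqF.
have vE a : VT / VP * a * (VP * tf) = VT * tf * a by field.
split=> //; rewrite -LE vE.
- by rewrite -/(target_x VT thT x0 tf) -xT xE cb sb sf.
- by rewrite -/(target_y VT thT y0 tf) -yT yE cb sb cf.
Qed.

End Interception.

Theorem theorem1 (R : realType) (VP rho VT thT x0 y0 phif : R)
  (hVP : 0 < VP) (hrho : 0 < rho) (hVT : 0 < VT) (hratio : VT / VP < 1)
  (hthT : 0 <= thT <= 2 * pi) (hphif : 0 <= phif < 2 * pi)
  (* target velocity in units of the pursuer's speed *)
  (vx vy : R) (hvx : vx = VT / VP * cos thT) (hvy : vy = VT / VP * sin thT)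
  (hvx0 : vx <> 0)
  (thf : R) (hthf : thf = final_heading phif thT)
  (tf : R) (u x y th : R -> R)
  (hsol : OCP_solution VP rho VT thT x0 y0 phif tf u x y th)
  (hdist : 4 * rho <= Num.sqrt (x tf ^+ 2 + y tf ^+ 2))
  (alpha d beta gamma : R) :
  (CSC_path VP rho tf u th TurnRight TurnRight alpha d beta gamma ->
   forall n : int, n_RR thf alpha gamma n ->
     RR_a1 rho x0 y0 vx vy thf
     + RR_a2 rho x0 vx thf n * sin beta
     + RR_a3 rho x0 y0 vx vy thf n * cos beta = 0)
  /\
  (CSC_path VP rho tf u th TurnLeft TurnLeft alpha d beta gamma ->
   forall n : int, n_LL thf alpha gamma n ->
     LL_b1 rho x0 y0 vx vy thf
     + LL_b2 rho x0 vx thf n * sin beta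
     + LL_b3 rho x0 y0 vx vy thf n * cos beta = 0)
  /\
  (CSC_path VP rho tf u th TurnRight TurnLeft alpha d beta gamma ->
   forall n : int, n_RL thf beta n ->
     RL_c1 rho x0 y0 vx vy thf
     + RL_c2 rho x0 vx vy thf n * sin beta
     + RL_c3 rho x0 y0 vx vy thf n * cos beta
     + beta * (RL_c4 rho vx * sin beta + RL_c5 rho vy * cos beta) = 0)
  /\
  (CSC_path VP rho tf u th TurnLeft TurnRight alpha d beta gamma ->
   forall n : int, n_LR thf beta n ->
     LR_d1 rho x0 y0 vx vy thf
     + LR_d2 rho x0 vx vy thf n * sin beta
     + LR_d3 rho x0 y0 vx vy thf n * cos beta
     + beta * (LR_d4 rho vx * sin beta + LR_d5 rho vy * cos beta) = 0).
Proof.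
have [thf_range _] := final_heading_spec hthT hphif.
rewrite -hthf in thf_range.
have target c1 c2 :
    CSC_path VP rho tf u th c1 c2 alpha d beta gamma -> _ :=
  fun path => CSC_interception hVP hrho hthT hphif hsol path.
have noloop c1 c2 :
    CSC_path VP rho tf u th c1 c2 alpha d beta gamma -> _ :=
  fun path => CSC_no_loop hVP hrho hsol hdist path.
have same c : CSC_path VP rho tf u th c c alpha d beta gamma -> _ :=
  fun path => CSC_same_turn hVP hrho hsol hdist path erefl.
split; [|split; [|split]] => path n hn;
  have [[a0 _ g0 b_range] _] := path;
  have [bA fA xE yE] := target _ _ path;
  have [a2 g2] := noloop _ _ path;
  move: xE yE bA fA; rewrite -hthf -hvx -hvy /= => xE yE bA fA.
- apply: (@RR_equation _ _ _ _ _ _ _ _ d (alpha + gamma)) => //.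
  + apply: RR_turning (same _ path) hn => //.
    by move: fA; rewrite !mulN1r opprD addrA.
  + by rewrite xE; ring.
  + by rewrite yE; ring.
- apply: (@LL_equation _ _ _ _ _ _ _ _ d (alpha + gamma)) => //.
  + apply: LL_turning (same _ path) hn => //.
    by move: fA; rewrite !mul1r addrA.
  + by rewrite xE; ring.
  + by rewrite yE; ring.
- apply: (@RL_equation _ _ _ _ _ _ _ _ d (alpha + gamma)) => //.
  + by apply: RL_turning a2 g2 hn => //; move: bA fA; rewrite !mulN1r ?mul1r.
  + by rewrite xE; ring.
  + by rewrite yE; ring.
- apply: (@LR_equation _ _ _ _ _ _ _ _ d (alpha + gamma)) => //.
  + by apply: LR_turning a2 g2 hn => //; move: bA fA; rewrite ?mulN1r !mul1r.
  + by rewrite xE; ring.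
  + by rewrite yE; ring.
Qed.
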